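(* A graph $G$ is a pseudo-cograph if and only if $|V(G)|\le2$ or $G$ can be explained by a labeled level-1 network $(N,t)$ that contains exactly one cycle $C$, where the root of $C$ is the root $\rho_N$ of $N$ and the hybrid-vertex $\eta_C$ of $C$ has exactly one child, which is a leaf.
   Context: Graphs finite, simple, undirected; $G-v$, join, cograph (no induced $P_4$). $G$ is a pseudo-cograph if $|V(G)|\le2$ or there are induced subgraphs $G_1,G_2$ and $v\in V(G)$ with (F1) $V(G)=V(G_1)\cup V(G_2)$, $V(G_1)\cap V(G_2)=\{v\}$, $|V(G_1)|,|V(G_2)|>1$; (F2) $G_1,G_2$ cographs; (F3) $G-v$ is the join or the disjoint union of $G_1-v$ and $G_2-v$. Network on finite $X$: a DAG $N=(V,E)$ with either $V=X=\{x\}$, or (N1) unique root $\rho_N$ of indegree 0, outdegree $\ge2$; (N2) $x\in X$ iff outdegree 0, indegree 1 (leaves); (N3) every other non-root vertex has indegree 1 and outdegree $\ge2$, or indegree 2 (hybrid-vertex) and outdegree $\ge1$. Level-1: every biconnected component of the underlying undirected graph contains at most one hybrid-vertex; then $\mathrm{lca}_N(x,y)$ is unique. Labeled network: $t:V\to\{0,1,\odot\}$, $t(v)=\odot$ iff $v\in X$; it explains $G$ if $G$ is isomorphic to the graph on $X$ with $x\ne y$ adjacent iff $t(\mathrm{lca}_N(x,y))=1$. A cycle is a biconnected component that is not a single vertex or edge; it consists of two internally disjoint directed paths from its root $\rho_C$ to its unique hybrid-vertex $\eta_C$. *)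

(* Defs.v *)
From mathcomp Require Import all_boot.
Set Implicit Arguments. Unset Strict Implicit. Unset Printing Implicit Defensive.

(* ---------- Graphs: T : finType, e : rel T (assumed symmetric, irreflexive) ---------- *)

Definition cograph_on (T : finType) (e : rel T) (A : {set T}) : Prop :=
  ~ exists a b c d, [/\ [/\ a \in A, b \in A, c \in A & d \in A],
                        [/\ e a b, e b c & e c d] &
                        [/\ ~~ e a c, ~~ e b d & ~~ e a d]].

Definition pseudo_cograph (T : finType) (e : rel T) : Prop :=
  #|T| <= 2 \/
  exists (A1 A2 : {set T}) (v : T),
    [/\ (* F1 *) A1 :|: A2 = [set: T], A1 :&: A2 = [set v], 1 < #|A1| /\ 1 < #|A2|,
        (* F2 *) cograph_on e A1 /\ cograph_on e A2 &
        (* F3: G - v is the join, resp. the disjoint union, of G1 - v and G2 - v *)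
        (forall x y, x \in A1 :\ v -> y \in A2 :\ v -> e x y) \/
        (forall x y, x \in A1 :\ v -> y \in A2 :\ v -> ~~ e x y)].

Section Net.
Variables (V : finType) (arc : rel V).

Definition indeg (v : V) : nat := #|[set u | arc u v]|.
Definition outdeg (v : V) : nat := #|[set w | arc v w]|.

Definition acyclic : Prop := forall x y, arc x y -> ~~ connect arc y x.

Definition leaf (v : V) : bool := outdeg v == 0.
Definition hybrid (v : V) : bool := indeg v == 2.

Definition is_network : Prop :=
  acyclic /\
  ( (#|V| = 1 /\ forall x y, ~~ arc x y) \/
    exists rho : V,
      [/\ indeg rho = 0, 2 <= outdeg rho &
          forall v, v != rho ->
            [\/ indeg v = 1 /\ outdeg v = 0,
                indeg v = 1 /\ 2 <= outdeg v
              | indeg v = 2 /\ 1 <= outdeg v]]).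

Definition net_root (rho : V) : Prop := indeg rho = 0.

Definition uadj : rel V := fun x y => arc x y || arc y x.

(* the induced undirected subgraph on B is connected (empty set counts as connected) *)
Definition uconnected_on (B : {set V}) : Prop :=
  forall x y, x \in B -> y \in B ->
    connect (fun a b => [&& a \in B, b \in B & uadj a b]) x y.

Definition biconnected_set (B : {set V}) : Prop :=
  B != set0 /\ uconnected_on B /\ forall w, w \in B -> uconnected_on (B :\ w).

Definition bicomponent (B : {set V}) : Prop :=
  biconnected_set B /\ forall B', biconnected_set B' -> B \subset B' -> B' = B.

Definition level1 : Prop :=
  is_network /\ forall B, bicomponent B -> #|[set v in B | hybrid v]| <= 1.

(* cycle: a biconnected component that is neither a single vertex nor a single edge *)
Definition is_cycle (C : {set V}) : Prop := bicomponent C /\ 2 < #|C|.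

Definition cycle_root (C : {set V}) (r : V) : Prop :=
  r \in C /\ forall u, u \in C -> ~~ arc u r.

(* the hybrid-vertex eta_C of a cycle: its (unique, by level-1) hybrid-vertex *)
Definition cycle_hybrid (C : {set V}) (h : V) : Prop := h \in C /\ hybrid h.

Definition is_lca (x y w : V) : Prop :=
  connect arc w x /\ connect arc w y /\
  forall w', w' != w -> connect arc w w' -> ~~ (connect arc w' x && connect arc w' y).

End Net.

Inductive label := L0 | L1 | Lodot.

Definition labeling (V : finType) (arc : rel V) (t : V -> label) : Prop :=
  forall v, t v = Lodot <-> leaf arc v.

Definition explains (T : finType) (e : rel T)
    (V : finType) (arc : rel V) (t : V -> label) : Prop :=
  exists f : T -> V,
    [/\ injective f,
        forall x, leaf arc (f x),
        forall v, leaf arc v -> exists x, f x = v &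
        forall x y, x != y -> forall w, is_lca arc (f x) (f y) w ->
          (e x y <-> t w = L1)].

(* Main.v *)
Require Import Defs.
From mathcomp Require Import all_boot.
Set Implicit Arguments. Unset Strict Implicit. Unset Printing Implicit Defensive.

(** A cograph is built from single vertices by disjoint unions and joins (its induced
    subgraphs or their complements are disconnected), so it is explained by a rooted tree
    whose leaves are its vertices; conversely every graph explained by a rooted tree is a
    cograph, since a P4 and its complement are connected.

    Given a pseudo-cograph, put a new root above the trees of G1 and G2, turn the leaf v of
    the second tree into a hybrid-vertex that also receives the arc into the leaf v of the
    first tree, and let this leaf hang below it. Only the new root lies above both parents
    of the hybrid-vertex, so lowest common ancestors are computed in one of the trees, or
    are the root. A biconnected set with more than two vertices has a sink with two
    parents, hence contains the hybrid-vertex and then the root; so any two cycles share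
    two vertices and coincide.

    Conversely, since the only cycle C passes through the root rho, no other vertex lies
    above both parents p1, p2 of its hybrid-vertex: it would separate rho from the
    hybrid-vertex in C. Split the vertices different from v according to whether they lie
    below a vertex u <> rho that is above p2. Two vertices on different sides have lowest
    common ancestor rho, and each side together with v is explained by the tree obtained
    by deleting one of the two arcs into the hybrid-vertex. If a side is empty, G itself
    is a cograph, and its decomposition yields that of a pseudo-cograph. *)

(** * Directed acyclic graphs *)

Section Dag.
Variables (V : finType) (arc : rel V).

Lemma leafP x : reflect (forall y, ~~ arc x y) (leaf arc x).
Proof.
apply: (iffP idP) => [|H].
  rewrite /leaf /outdeg cards_eq0 => /eqP H y.
  by apply/negP => xy; have := in_set0 y; rewrite -H inE xy.
by rewrite /leaf /outdeg cards_eq0; apply/eqP/setP => y; rewrite !inE; apply/negbTE.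
Qed.

Lemma connect_first x y :
  connect arc x y -> x = y \/ exists2 z, arc x z & connect arc z y.
Proof.
case/connectP => -[|z p] /=; first by move=> _ ->; left.
case/andP => xz zp ->; right; exists z => //; apply/connectP; by exists p.
Qed.

Lemma connect_last x y :
  connect arc x y -> x = y \/ exists2 z, connect arc x z & arc z y.
Proof.
case/connectP => p; case/lastP: p => [|p z] /=; first by move=> _ ->; left.
rewrite rcons_path last_rcons => /andP[xp pz] ->; right.
by exists (last x p) => //; apply/connectP; exists p.
Qed.

Lemma connect_invariant (P : pred V) x y :
  (forall a b, P a -> arc a b -> P b) -> P x -> connect arc x y -> P y.
Proof.
move=> inv + /connectP[p]; elim: p x => [|z p IH] x /=; first by move=> Px _ ->.
by move=> Px /andP[/(inv _ _ Px) Pz zp]; apply: IH.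
Qed.

Lemma connect_leaf x y : leaf arc x -> connect arc x y -> y = x.
Proof.
by move/leafP=> lx /connect_first[->|[z]] //; rewrite (negbTE (lx z)).
Qed.

Lemma connect_source x y : (forall u, ~~ arc u y) -> connect arc x y -> x = y.
Proof. by move=> ny /connect_last[//|[z _]]; rewrite (negbTE (ny z)). Qed.

Lemma indeg_eq0 x : indeg arc x = 0 -> forall u, ~~ arc u x.
Proof.
by move/eqP; rewrite /indeg cards_eq0 => /eqP H u; move/setP: H => /(_ u); rewrite !inE => ->.
Qed.

Hypothesis acy : acyclic arc.

Lemma acyclic_anti x y : connect arc x y -> connect arc y x -> x = y.
Proof.
case/connect_first => // -[z xz zy] yx.
by have := acy xz; rewrite (connect_trans zy yx).
Qed.

(** In an acyclic digraph this number drops strictly along every nontrivial path, so its minimizers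
    and maximizers are lowest and highest vertices with a given property. *)
Let desc x := #|[set z | connect arc x z]|.

Let desc_ltn x y : connect arc x y -> x != y -> desc y < desc x.
Proof.
move=> xy nxy; apply/proper_card/properP; split.
  by apply/subsetP => z; rewrite !inE; apply: connect_trans.
exists x; rewrite !inE ?connect0 //; apply: contra nxy => yx.
by rewrite (acyclic_anti xy yx).
Qed.

Lemma acyclic_lowest (P : pred V) w0 : P w0 ->
  exists w, P w /\ forall w', w' != w -> connect arc w w' -> ~~ P w'.
Proof.
move=> Pw0; case: (arg_minnP desc Pw0) => w Pw mw; exists w; split=> // w' nw ww'.
by apply/negP => /mw; rewrite leqNgt desc_ltn // eq_sym.
Qed.

Lemma acyclic_highest (P : pred V) w0 : P w0 ->
  exists w, P w /\ forall w', w' != w -> connect arc w' w -> ~~ P w'.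
Proof.
move=> Pw0; case: (arg_maxnP desc Pw0) => w Pw mw; exists w; split=> // w' nw ww'.
by apply/negP => /mw; rewrite /= leqNgt desc_ltn.
Qed.

(** A highest ancestor of [x] has no parent, since that parent would be a higher ancestor; hence it
    is [r]. *)
Lemma root_reaches_all r : (forall x, x != r -> exists u, arc u x) ->
  forall x, connect arc r x.
Proof.
move=> par x; case: (@acyclic_highest (fun u => connect arc u x) x) => // u [ux hu].
case: (eqVneq u r) => [<- //|/par[p pu]].
have pu' : p != u by apply/eqP => E; have := acy pu; rewrite E connect0.
by have := hu p pu' (connect1 pu); rewrite (connect_trans (connect1 pu) ux).
Qed.

End Dag.

(** * Rooted forests and cographs *)

Definition unique_parents (V : finType) (arc : rel V) :=
  forall u u' x, arc u x -> arc u' x -> u = u'.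

(** Induction on the path into [x] from its end: unless one of the ancestors is [x] itself, both lie
    above the only parent of [x]. *)
Lemma ancestors_chain (V : finType) (arc : rel V) : unique_parents arc ->
  forall u u' x, connect arc u x -> connect arc u' x -> connect arc u u' || connect arc u' u.
Proof.
move=> up u u' x /connectP[p]; elim/last_ind: p x => [|p z IH] x /=.
  by move=> _ -> ->; rewrite orbT.
rewrite rcons_path last_rcons => /andP[pu pz] -> /connect_last[->|[z' uz' z'z]].
  by apply/orP; left; apply/connectP; exists (rcons p z); rewrite ?last_rcons // rcons_path pu.
by apply: (IH (last u p)) => //; rewrite (up _ _ _ pz z'z).
Qed.

(* P4 and its complement are connected, so the relation "below a common vertex
   strictly below w" glues the four vertices together under a vertex lower than
   their lowest common ancestor w. *)
Lemma forest_cograph (T V : finType) (e : rel T) (arc : rel V) (t : V -> label)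
    (f : T -> V) (A : {set T}) (r : V) :
  symmetric e -> irreflexive e -> acyclic arc -> unique_parents arc ->
  (forall x, x \in A -> connect arc r (f x)) ->
  (forall x y w, x \in A -> y \in A -> x != y -> is_lca arc (f x) (f y) w ->
     (e x y <-> t w = L1)) ->
  cograph_on e A.
Proof.
move=> esym eirr acy up rA expl [a [b [c [d]]]].
case=> -[aA bA cA dA] [ab bc cd] [ac bd ad].
pose P w := [&& connect arc w (f a), connect arc w (f b), connect arc w (f c) & connect arc w (f d)].
have Pr : P r by rewrite /P !rA.
case: (acyclic_lowest acy Pr) => w [/and4P[wa wb wc wd] low].
have ab' : a != b by apply: contraTneq ab => ->; rewrite eirr.
have bc' : b != c by apply: contraTneq bc => ->; rewrite eirr.
have cd' : c != d by apply: contraTneq cd => ->; rewrite eirr.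
have ac' : a != c by apply: contraNneq ad => ->.
have bd' : b != d by apply: contraNneq ad => <-.
have ad' : a != d by apply: contraTneq ab => ->; rewrite esym.
pose S x y := [exists c', [&& c' != w, connect arc w c', connect arc c' (f x) & connect arc c' (f y)]].
have glue x y : x \in A -> y \in A -> x != y -> connect arc w (f x) -> connect arc w (f y) ->
    ~ (e x y <-> t w = L1) -> S x y.
  move=> xA yA xy wx wy ne; case: (boolP (S x y)) => // nS; case: ne; apply: expl => //.
  split=> //; split=> // w' nw ww'; apply/negP => w'xy; case/negP: nS.
  by apply/existsP; exists w'; rewrite nw ww'.
(* Two vertices above a common leaf are comparable, and the higher one lies above all leaves that
   either of them covers. *)
have S_chain x y z u : S x y -> S y z -> S z u ->
    exists c', [/\ c' != w, connect arc w c' &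
       [/\ connect arc c' (f x), connect arc c' (f y), connect arc c' (f z) & connect arc c' (f u)]].
  case/existsP => c1 /and4P[n1 w1 x1 y1] /existsP[c2 /and4P[n2 w2 y2 z2]].
  case/existsP => c3 /and4P[n3 w3 z3 u3].
  have [m [nm wm xm [ym zm]]] : exists m, [/\ m != w, connect arc w m, connect arc m (f x) &
      connect arc m (f y) /\ connect arc m (f z)].
    case/orP: (ancestors_chain up y1 y2) => h.
      by exists c1; split=> //; split=> //; apply: connect_trans z2.
    by exists c2; split=> //; apply: connect_trans h _.
  case/orP: (ancestors_chain up zm z3) => h.
    by exists m; split=> //; split=> //; apply: connect_trans u3.
  by exists c3; split=> //; split=> //; apply: connect_trans h _.
suff [c' [n1 n2 [ha hb hc hd]]] : exists c', [/\ c' != w, connect arc w c' &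
    [/\ connect arc c' (f a), connect arc c' (f b), connect arc c' (f c) & connect arc c' (f d)]].
  by have := low c' n1 n2; rewrite /P ha hb hc hd.
(* If [w] has label [L1], it is not the lowest common ancestor of any non-adjacent pair, which glues
   along the complementary path c - a - d - b; otherwise the adjacent pairs glue along a - b - c -
   d. *)
have [tw|tw] : t w = L1 \/ t w <> L1 by case: (t w); [right|left|right].
  have [||| c' [n1 n2 [hc ha hd hb]]] := S_chain c a d b; last by exists c'.
  - by apply: glue; rewrite 1?eq_sym // esym (negbTE ac) => -[_ /(_ tw)].
  - by apply: glue; rewrite // (negbTE ad) => -[_ /(_ tw)].
  - by apply: glue; rewrite 1?eq_sym // esym (negbTE bd) => -[_ /(_ tw)].
have [||| c' [n1 n2 [ha hb hc hd]]] := S_chain a b c d; last by exists c'.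
- by apply: glue => // -[/(_ ab)].
- by apply: glue => // -[/(_ bc)].
- by apply: glue => // -[/(_ cd)].
Qed.

(** * Biconnected sets *)

Section Biconnected.
Variables (V : finType) (arc : rel V).

Definition uadj_in (B : {set V}) : rel V := fun a b => [&& a \in B, b \in B & uadj arc a b].

Lemma uadj_sym : symmetric (uadj arc).
Proof. by move=> x y; rewrite /uadj orbC. Qed.

Lemma uadj_in_sym B : connect_sym (uadj_in B).
Proof. by apply: sym_connect_sym => x y; rewrite /uadj_in uadj_sym andbCA. Qed.

Lemma uadj_in_sub (B B' : {set V}) x y : B \subset B' ->
  connect (uadj_in B) x y -> connect (uadj_in B') x y.
Proof.
move=> /subsetP BB'; apply: connect_sub => a b /and3P[aB bB ab].
by apply: connect1; rewrite /uadj_in !BB'.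
Qed.

Lemma uconnected_hub (B : {set V}) a :
  (forall x, x \in B -> connect (uadj_in B) a x) -> uconnected_on arc B.
Proof.
move=> H x y xB yB; apply: connect_trans (H y yB).
by rewrite uadj_in_sym H.
Qed.

Lemma uconnected_setD1 B w : biconnected_set arc B -> uconnected_on arc (B :\ w).
Proof.
case=> _ [cB cBw]; have [|nw] := boolP (w \in B); first exact: cBw.
suff -> : B :\ w = B by [].
by apply/setP => x; rewrite !inE; case: (eqVneq x w) => // ->; rewrite (negbTE nw).
Qed.

(** Whichever vertex is deleted, [a] or [b] survives and links what is left of the two sets. *)
Lemma biconnected_setU (B B' : {set V}) a b :
  a != b -> a \in B -> b \in B -> a \in B' -> b \in B' ->
  biconnected_set arc B -> biconnected_set arc B' -> biconnected_set arc (B :|: B').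
Proof.
move=> ab aB bB aB' bB' cB cB'.
have hub w z : z != w -> z \in B -> z \in B' -> uconnected_on arc ((B :|: B') :\ w).
  move=> zw zB zB'; apply: (@uconnected_hub _ z) => x; rewrite !inE => /andP[xw].
  case/orP => xB.
    apply: (@uadj_in_sub (B :\ w)); first by rewrite setSD // subsetUl.
    by apply: (@uconnected_setD1 _ w cB z x); rewrite !inE ?zw ?xw.
  apply: (@uadj_in_sub (B' :\ w)); first by rewrite setSD // subsetUr.
  by apply: (@uconnected_setD1 _ w cB' z x); rewrite !inE ?zw ?xw.
split; first by apply/set0Pn; exists a; rewrite inE aB.
split=> [|w _].
  apply: (@uconnected_hub _ a) => x; rewrite inE => /orP[] xB.
    by apply: (@uadj_in_sub B); [exact: subsetUl | case: cB => _ [+ _]; apply].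
  by apply: (@uadj_in_sub B'); [exact: subsetUr | case: cB' => _ [+ _]; apply].
case: (eqVneq a w) => [aw|aw]; last exact: (hub w a).
by apply: (hub w b) => //; rewrite -aw eq_sym.
Qed.

(** Boolean form of biconnectedness, from which [maxset_exists] yields a maximal biconnected
    superset. *)
Definition biconnected_setb (B : {set V}) : bool :=
    [&& B != set0, [forall x in B, forall y in B, connect (uadj_in B) x y] &
        [forall w in B, forall x in B :\ w, forall y in B :\ w, connect (uadj_in (B :\ w)) x y]].

Lemma biconnected_setP (B : {set V}) :
  reflect (biconnected_set arc B) (biconnected_setb B).
Proof.
apply: (iffP and3P) => [[B0 /forall_inP c /forall_inP cw]|[B0 [c cw]]].
  split=> //; split=> [x y xB yB|w wB x y xB yB]; first by have /forall_inP := c x xB; apply.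
  by have /forall_inP/(_ x xB)/forall_inP := cw w wB; apply.
split=> //; first by apply/forall_inP => x xB; apply/forall_inP => y; apply: c.
by apply/forall_inP => w wB; apply/forall_inP => x xB; apply/forall_inP => y; apply: cw.
Qed.

Lemma bicomponent_exists (B : {set V}) : biconnected_set arc B ->
  exists2 C, bicomponent arc C & B \subset C.
Proof.
move=> /biconnected_setP bB; have [C /maxsetP[bC mC] BC] := maxset_exists (P := biconnected_setb) bB.
exists C => //; split; first exact/biconnected_setP.
by move=> B' /biconnected_setP bB' CB'; apply: mC.
Qed.

Lemma path_uadj_in (B : {set V}) x p y : path (uadj arc) x p ->
  {subset x :: p <= B} -> y \in x :: p -> connect (uadj_in B) x y.
Proof.
elim: p x => [|z p IH] x /=; first by rewrite inE => _ _ /eqP->.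
case/andP => xz zp sub; rewrite inE => /predU1P[->//|yp].
apply: (@connect_trans _ _ z).
  by apply: connect1; rewrite /uadj_in xz !sub // !inE eqxx ?orbT.
by apply: IH => // u up; apply: sub; rewrite inE up orbT.
Qed.

(** A cycle without one of its vertices is a path; the cycle is rotated so that the deleted vertex
    comes first. *)
Lemma ucycle_biconnected s : s != [::] -> cycle (uadj arc) s -> uniq s ->
  biconnected_set arc [set x in s].
Proof.
move=> s0 cs us; split.
  by case: s s0 {cs us} => // x s _; apply/set0Pn; exists x; rewrite inE mem_head.
split=> [|w].
  case: s s0 cs {us} => //= x s _; rewrite rcons_path => /andP[xs _].
  apply: (@uconnected_hub _ x) => y; rewrite inE => ys.
  by apply: (path_uadj_in xs) => // z zs; rewrite inE.
rewrite inE => /rot_to[i s' Es].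
have ms z : (z \in s) = (z \in w :: s') by rewrite -Es mem_rot.
have : cycle (uadj arc) (w :: s') by rewrite -Es rot_cycle.
have : uniq (w :: s') by rewrite -Es rot_uniq.
case: s' ms {Es} => [|x s'] ms.
  move=> _ _ x y; rewrite in_setD1 inE ms inE => /andP[/negbTE->].
  by [].
move=> /= /andP[ws us'] /andP[_]; rewrite rcons_path => /andP[xs _].
have sub z : z \in x :: s' -> z \in [set x in s] :\ w.
  by move=> zs; rewrite !inE ms inE zs orbT andbT; apply: contraNneq ws => <-.
apply: (@uconnected_hub _ x) => y; rewrite !inE ms in_cons => /andP[/negbTE->] /= ys.
exact: (path_uadj_in xs sub ys).
Qed.

Lemma connect_uniq_path x y : connect arc x y ->
  exists p, [/\ path arc x p, uniq (x :: p), y = last x p &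
     forall z, z \in x :: p -> connect arc x z /\ connect arc z y].
Proof.
case/connectP => p0 p0x ->; case/shortenP: p0x => p px up _.
exists p; split=> // z zp; split; first exact: (path_connect px).
case/splitPl: zp px => p1 p2 <-; rewrite cat_path last_cat => /andP[_ p2x].
by apply/connectP; exists p2.
Qed.

Hypothesis acy : acyclic arc.

(** The paths from [w] to the two parents meet only in [w], because any other common vertex would be
    a lower common ancestor; through [h] they close up to a cycle. *)
Lemma two_parents_biconnected w q1 q2 h :
  q1 != q2 -> arc q1 h -> arc q2 h -> is_lca arc q1 q2 w ->
  exists B, [/\ biconnected_set arc B, w \in B, h \in B & 2 < #|B|].
Proof.
move=> q12 a1 a2 [c1 [c2 low]].
have [p1 [px1 u1 l1 m1]] := connect_uniq_path c1.
have [p2 [px2 u2 l2 m2]] := connect_uniq_path c2.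
have h1 : h \notin w :: p1 by apply/negP => /m1[_ hq]; have := acy a1; rewrite hq.
have h2 : h \notin w :: p2 by apply/negP => /m2[_ hq]; have := acy a2; rewrite hq.
pose s := w :: p1 ++ h :: rev p2.
have sub x p : path arc x p -> path (uadj arc) x p.
  by apply: sub_path => a b ab; rewrite /uadj ab.
have us : uniq s.
  rewrite /s -cat_cons cat_uniq u1 /= negb_or h1 /= rev_uniq mem_rev.
  move: h2 u2; rewrite inE negb_or => /andP[_ ->] /= /andP[w2 ->]; rewrite !andbT.
  apply/hasPn => z; rewrite mem_rev => z2; apply/negP => z1.
  have [wz zq1] := m1 z z1; have [_ zq2] := m2 z (mem_behead (s := w :: p2) z2).
  have zw : z != w by apply: contraNneq w2 => <-.
  by have := low z zw wz; rewrite zq1 zq2.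
have cs : cycle (uadj arc) s.
  rewrite /= rcons_cat cat_path sub //= -l1 {1}/uadj a1 /=.
  have := rev_path (uadj arc) w (rcons p2 h).
  rewrite last_rcons belast_rcons rev_cons => ->.
  rewrite (eq_path (e' := uadj arc)); last by move=> a b; exact: uadj_sym.
  by rewrite rcons_path sub // -l2 /uadj a2.
exists [set x in s]; split.
- exact: ucycle_biconnected.
- by rewrite inE mem_head.
- by rewrite inE in_cons mem_cat mem_head !orbT.
(* There is a third vertex besides [w] and [h]: as [q1] and [q2] differ, the two paths are not both
   trivial. *)
rewrite cardsE (card_uniqP us) /= size_cat /= size_rev addnS.
case: p1 p2 l1 l2 {px1 px2 u1 u2 m1 m2 h1 h2 s us cs} => [|? ?] [|? ?] //= l1 l2.
by case/eqP: q12; rewrite l1 l2.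
Qed.

(** The neighbours in [B] of a lowest vertex [w] of [B] are all parents of [w], and a single one of
    them would separate [w] from the rest of [B]. *)
Lemma biconnected_sink B : biconnected_set arc B -> 2 < #|B| ->
  exists w q1 q2, [/\ w \in B, q1 \in B, q2 \in B, q1 != q2 & arc q1 w /\ arc q2 w].
Proof.
move=> bB cB; have [_ [_ _]] := bB.
have /set0Pn[b0 b0B] : B != set0 by rewrite -card_gt0 (ltn_trans _ cB).
have [w [wB low]] := acyclic_lowest acy (P := fun x => x \in B) b0B.
(* Since [B :\ z] is connected and contains a vertex besides [w], a neighbour of [w] survives the
   deletion of [z]. This is used first with an arbitrary [z0], then with the parent [q1] so
   obtained. *)
have nb z : z != w -> exists2 q, arc q w & (q \in B) && (q != z).
  move=> zw; have [x] : exists x, x \in B :\: [set w; z].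
    apply/set0Pn; rewrite -card_gt0 cardsD subn_gt0 (leq_ltn_trans _ cB) //.
    by apply: leq_trans (subset_leq_card (subsetIr _ _)) _; rewrite cards2; case: eqP.
  rewrite !inE negb_or => /andP[/andP[xw xz] xB].
  have := @uconnected_setD1 _ z bB w x.
  rewrite !inE wB xB xz eq_sym zw => /(_ isT isT) /connect_first[E|[q]].
    by rewrite E eqxx in xw.
  rewrite !inE => /and3P[_ /andP[qz qB]] /orP[wq _|qw _]; last by exists q; rewrite ?qB.
  have qw : q != w by apply/eqP => E; have := acy wq; rewrite E connect0.
  by have := low q qw (connect1 wq); rewrite /= qB.
have [z0 z0w] : exists z0, z0 != w.
  by have /card_gt1P[x [y [_ _]]] := ltnW cB; case: (eqVneq x w) => [-> yw|]; [exists y; rewrite eq_sym|exists x].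
have [q1 a1 /andP[q1B _]] := nb z0 z0w.
have q1w : q1 != w by apply/eqP => E; have := acy a1; rewrite E connect0.
have [q2 a2 /andP[q2B q21]] := nb q1 q1w.
by exists w, q1, q2; rewrite eq_sym.
Qed.

End Biconnected.

(** * Decomposition of cographs *)

Definition cross_const (T : finType) (e : rel T) (B1 B2 : {set T}) :=
  (forall x y, x \in B1 -> y \in B2 -> e x y) \/
  (forall x y, x \in B1 -> y \in B2 -> ~~ e x y).

Definition decomposable (T : finType) (e : rel T) (A : {set T}) :=
  exists B1 B2 : {set T}, [/\ B1 != set0, B2 != set0, B1 :&: B2 = set0,
    B1 :|: B2 = A & cross_const e B1 B2].

Definition co_rel (T : eqType) (e : rel T) : rel T := fun x y => (x != y) && ~~ e x y.

Lemma co_rel_sym (T : eqType) (e : rel T) : symmetric e -> symmetric (co_rel e).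
Proof. by move=> es x y; rewrite /co_rel es eq_sym. Qed.

Lemma co_rel_irr (T : eqType) (e : rel T) : irreflexive (co_rel e).
Proof. by move=> x; rewrite /co_rel eqxx. Qed.

Lemma cograph_on_sub (T : finType) (e : rel T) (A B : {set T}) :
  B \subset A -> cograph_on e A -> cograph_on e B.
Proof.
move=> /subsetP BA cA [a [b [c [d [[aB bB cB dB] E N]]]]]; apply: cA.
by exists a, b, c, d; split=> //; split; apply: BA.
Qed.

(* The complement of the path a - b - c - d is the path b - d - a - c. *)
Lemma cograph_on_co (T : finType) (e : rel T) (A : {set T}) :
  symmetric e -> cograph_on e A -> cograph_on (co_rel e) A.
Proof.
move=> es cA [a [b [c [d [[aB bB cB dB] [ab bc cd] [ac bd ad]]]]]]; apply: cA.
have nac : a != c by apply: contraNneq ad => ->.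
have nbd : b != d by apply: contraNneq ad => <-.
have nad : a != d by apply: contraNneq ac => ->; rewrite co_rel_sym.
move: ab bc cd ac bd ad; rewrite /co_rel nac nbd nad /= !negbK.
move=> /andP[_ ab] /andP[_ bc] /andP[_ cd] ac bd ad.
exists c, a, d, b; split=> //; split=> //; first by rewrite es.
  by rewrite es.
by rewrite es.
Qed.

(** If [x] is adjacent to all of [A :\ x], it splits off as a join. Otherwise let [K] be the
    component in [A :\ x] of a non-neighbour [y] of [x]. If [x] has no neighbour in [K], then [K]
    splits off as a disjoint union; if it has one, then [x |: K] does. *)
Lemma cograph_extend_disconnected (T : finType) (e : rel T) (A B1 B2 : {set T}) x :
  symmetric e -> irreflexive e -> cograph_on e A -> x \in A ->
  B1 != set0 -> B2 != set0 -> B1 :&: B2 = set0 -> B1 :|: B2 = A :\ x ->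
  (forall y z, y \in B1 -> z \in B2 -> ~~ e y z) -> decomposable e A.
Proof.
move=> es ei cA xA n1 n2 I0 U N.
have [xall|] := boolP [forall y in A :\ x, e x y].
  exists [set x], (A :\ x); split.
  - by apply/set0Pn; exists x; rewrite inE.
  - by case/set0Pn: n1 => y yB; apply/set0Pn; exists y; rewrite -U inE yB.
  - by apply/setP => z; rewrite !inE; case: (z =P x).
  - by rewrite setD1K.
  by left=> y z /set1P-> zA; apply: (forall_inP xall).
rewrite negb_forall => /existsP[y]; rewrite negb_imply => /andP[yA nxy].
pose R a b := [&& a \in A :\ x, b \in A :\ x & e a b].
pose K := [set z | connect R y z].
(* [K] stays inside the one of [B1], [B2] that contains [y], so it misses the other one. *)
have [u uA uK] : exists2 u, u \in A :\ x & u \notin K.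
  have miss (C D : {set T}) : C :|: D = A :\ x -> C :&: D = set0 -> D != set0 ->
      (forall y z, y \in C -> z \in D -> ~~ e y z) -> y \in C ->
      exists2 u, u \in A :\ x & u \notin K.
    move=> CD CD0 /set0Pn[u uD] N' yC; exists u; first by rewrite -CD inE uD orbT.
    apply/negP; rewrite inE => uK; have := in_set0 u; rewrite -CD0 inE uD andbT => /negP; apply.
    apply: (connect_invariant (P := fun z => z \in C) _ yC uK) => a b aC /and3P[_ bA ab].
    by move: bA; rewrite -CD inE => /orP[//|bD]; have := N' a b aC bD; rewrite ab.
  have : y \in B1 :|: B2 by rewrite U.
  case/setUP; first exact: (miss B1 B2).
  by apply: (miss B2 B1); rewrite 1?setUC 1?setIC // => a b aB bB; rewrite es N.
have KA z : z \in K -> z \in A :\ x.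
  by rewrite inE => /(connect_invariant (P := fun z => z \in A :\ x)); apply=> // a b _ /and3P[].
have Kcl k z : k \in K -> z \in A :\ x -> z \notin K -> ~~ e k z.
  move=> kK zA; apply: contraNN => kz; rewrite inE in kK; rewrite inE.
  by apply: (connect_trans kK); apply: connect1; rewrite /R zA kz KA // inE.
have yK : y \in K by rewrite inE connect0.
have [/existsP[z /andP[zK xz]]|] := boolP [exists z in K, e x z]; last first.
  rewrite negb_exists => /forallP nx; exists K, (A :\: K); split.
  - by apply/set0Pn; exists y.
  - by apply/set0Pn; exists x; rewrite inE xA andbT; apply/negP => /KA; rewrite !inE eqxx.
  - by apply/setP => k; rewrite !inE; case: connect.
  - apply/setP => k; rewrite !in_setU !in_setD; case: (boolP (k \in K)) => //= /KA.
    by rewrite inE => /andP[_ ->].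
  right=> k w kK; rewrite inE => /andP[wK wA]; case: (eqVneq w x) => [->|wx].
    by have := nx k; rewrite kK es.
  by apply: Kcl => //; rewrite !inE wx.
(* A walk in [K] from [y] to the neighbour [z] of [x] has an edge from a non-neighbour [a] of [x] to
   a neighbour [b]; if [w] were adjacent to [x], then a - b - x - w would be an induced P4. *)
have nxu w : w \in A :\ x -> w \notin K -> ~~ e x w.
  move=> wA wK; apply/negP => xw.
  have : connect R y z && ~~ e x z.
    have yz : connect R y z by rewrite inE in zK.
    apply: (connect_invariant (P := fun z => connect R y z && ~~ e x z) _ _ yz) => [a b|].
      case/andP => ya xa ab; rewrite (connect_trans ya (connect1 ab)) /=.
      case/and3P: ab => aA bA ab; apply/negP => xb; apply: cA.
      have aK : a \in K by rewrite inE.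
      have bK : b \in K.
        by rewrite inE; apply: (connect_trans ya); apply: connect1; rewrite /R aA bA.
      exists a, b, x, w; split; split=> //.
      - by case/setD1P: aA.
      - by case/setD1P: bA.
      - by case/setD1P: wA.
      - by rewrite es.
      - by rewrite es.
      - exact: Kcl.
      - exact: Kcl.
    by rewrite connect0.
  by rewrite xz andbF.
exists (x |: K), ((A :\ x) :\: K); split.
- by apply/set0Pn; exists x; rewrite !inE eqxx.
- by apply/set0Pn; exists u; rewrite in_setD uK.
- by apply/setP => k; rewrite !inE; case: (k =P x); rewrite ?andbF //=; case: connect.
- apply/setP => k; rewrite in_setU in_setD in_setU1 in_setD1.
  case: (eqVneq k x) => [->|kx] /=; first by rewrite xA.
  by case: (boolP (k \in K)) => // /KA; rewrite inE => /andP[_ ->].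
right=> k w; rewrite in_setU1 in_setD => kK /andP[wK wA].
by case/predU1P: kK => [->|kK]; [exact: nxu | exact: Kcl].
Qed.

(** Induction by deleting a vertex [x]. If [A :\ x] is a disjoint union, the previous lemma applies;
    if it is a join, its complement is disconnected, and the lemma is applied to the complement,
    with its two outcomes exchanged on the way back. *)
Lemma cograph_decomposable (T : finType) (e : rel T) (A : {set T}) :
  symmetric e -> irreflexive e -> 1 < #|A| -> cograph_on e A -> decomposable e A.
Proof.
move=> es ei; have [n] := ubnP #|A|; elim: n A => // n IH A /ltnSE An A1 cA.
have /set0Pn[x xA] : A != set0 by rewrite -card_gt0 ltnW.
have cAx : #|A| = #|A :\ x|.+1 by rewrite (cardsD1 x A) xA.
have [Ax1|] := ltnP 1 #|A :\ x|; last first.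
  move=> Ax1; have /cards1P[y Ey] : #|A :\ x| == 1 by rewrite eqn_leq Ax1 -ltnS -cAx.
  have yx : y != x by have := set11 y; rewrite -Ey !inE => /andP[].
  exists [set x], [set y]; split.
  - by apply/set0Pn; exists x; rewrite inE.
  - by apply/set0Pn; exists y; rewrite inE.
  - by apply/setP => z; rewrite !inE; case: (z =P x) => // ->; rewrite eq_sym (negbTE yx).
  - by rewrite -Ey setD1K.
  by case: (boolP (e x y)) => xy; [left|right] => ? ? /set1P-> /set1P->.
have [||| B1 [B2 [n1 n2 I0 U [N|N]]]] := IH (A :\ x).
- by rewrite cAx in An.
- by [].
- exact: cograph_on_sub (subsetDl _ _) cA.
- have cross_neq B C y z : B :&: C = set0 -> y \in B -> z \in C -> y != z :> T.
    move=> BC yB zC; apply/negP => /eqP E; have := in_set0 y.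
    by rewrite -BC inE yB E zC.
  have [|C1 [C2 [m1 m2 J0 W X]]] := @cograph_extend_disconnected _ (co_rel e) A B1 B2 x
    (co_rel_sym es) (@co_rel_irr _ e) (cograph_on_co es cA) xA n1 n2 I0 U.
    by move=> y z yB zB; rewrite /co_rel N // andbF.
  exists C1, C2; split=> //.
  case: X => X; [right|left].
    by move=> y z yC zC; have := X y z yC zC; rewrite /co_rel (cross_neq _ _ _ _ J0 yC zC).
  move=> y z yC zC; have := X y z yC zC.
  by rewrite /co_rel (cross_neq _ _ _ _ J0 yC zC) //= negbK.
exact: cograph_extend_disconnected n1 n2 I0 U N.
Qed.

(** With more than two vertices, one part of a decomposition has at least two; any vertex [v] of
    that part can be added to the other part. *)
Lemma cograph_pseudo_cograph (T : finType) (e : rel T) :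
  symmetric e -> irreflexive e -> cograph_on e [set: T] -> pseudo_cograph e.
Proof.
move=> es ei cT; have [|T2] := leqP #|T| 2; first by left.
have T1 : 1 < #|[set: T]| by rewrite cardsT ltnW.
right; have [B1 [B2 [n1 n2 I0 U X]]] := cograph_decomposable es ei T1 cT.
have build (C D : {set T}) : 1 < #|C| -> D != set0 -> C :&: D = set0 ->
    C :|: D = [set: T] -> cross_const e C D -> 
    exists (A1 A2 : {set T}) (v : T),
    [/\ A1 :|: A2 = [set: T], A1 :&: A2 = [set v], 1 < #|A1| /\ 1 < #|A2|,
        cograph_on e A1 /\ cograph_on e A2 &
        (forall x y, x \in A1 :\ v -> y \in A2 :\ v -> e x y) \/
        (forall x y, x \in A1 :\ v -> y \in A2 :\ v -> ~~ e x y)].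
  move=> C1 D0 CD0 CDT CDX.
  have /set0Pn[v vC] : C != set0 by rewrite -card_gt0 ltnW.
  have vD : v \notin D by apply/negP => vD; have := in_set0 v; rewrite -CD0 inE vC vD.
  exists C, (v |: D), v; split.
  - by rewrite setUCA CDT setUT.
  - by rewrite setIUr CD0 setU0; apply/setIidPr; rewrite sub1set.
  - by split=> //; rewrite cardsU1 vD add1n ltnS card_gt0.
  - by split; apply: cograph_on_sub cT; apply: subsetT.
  by case: CDX => H; [left|right] => x y /setD1P[_ xC] /setD1P[/negbTE yv];
    rewrite in_setU1 yv => yD; apply: H.
have [B11|B11] := ltnP 1 #|B1|; first exact: (build B1 B2).
apply: (build B2 B1); rewrite // 1?setIC 1?setUC //.
  have := cardsU B1 B2; rewrite U cardsT I0 cards0 subn0 => E.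
  by rewrite ltnNge; apply/negP => B21; have := leq_add B11 B21; rewrite -E leqNgt T2.
by case: X => H; [left|right] => x y xB yB; rewrite es; apply: H.
Qed.

(** * From networks to pseudo-cographs *)

Section Unicyclic.
Variables (T : finType) (e : rel T) (V : finType) (arc : rel V) (t : V -> label) (f : T -> V).
Variables (rho h p q v0 : V) (v : T).
Hypotheses (esym : symmetric e) (eirr : irreflexive e) (acy : acyclic arc).
Hypothesis rho_src : forall u, ~~ arc u rho.
Hypothesis rho_top : forall x, connect arc rho x.
Hypothesis pq : p != q.
Hypothesis parents_h : forall u, arc u h = (u == p) || (u == q).
Hypothesis tree_vertex : forall x u u', x != h -> arc u x -> arc u' x -> u = u'.
Hypothesis children_h : forall c, arc h c = (c == v0).
Hypothesis leaf_v0 : leaf arc v0.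
Hypothesis f_inj : injective f.
Hypothesis f_leaf : forall x, leaf arc (f x).
Hypothesis fv : f v = v0.
Hypothesis expl : forall x y, x != y -> forall w, is_lca arc (f x) (f y) w ->
  (e x y <-> t w = L1).

Definition cut_arc : rel V := fun a b => arc a b && ~~ ((a == q) && (b == h)).

Lemma cut_sub x y : connect cut_arc x y -> connect arc x y.
Proof. by apply: connect_sub => a b /andP[ab _]; apply: connect1. Qed.

Lemma cut_acyclic : acyclic cut_arc.
Proof.
move=> x y /andP[xy _]; apply/negP => /cut_sub yx.
by have := acy xy; rewrite yx.
Qed.

Lemma cut_unique_parents : unique_parents cut_arc.
Proof.
move=> u u' x /andP[ux nu] /andP[u'x nu']; case: (eqVneq x h) => [E|xh].
  move: ux u'x nu nu'; rewrite E eqxx !andbT !parents_h.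
  by case/orP=> [/eqP->|->] // /orP[/eqP->|->].
exact: tree_vertex xh ux u'x.
Qed.

(** A path that uses the deleted arc passes through [h], which puts its end below [h]. *)
Lemma cut_connect u x : connect arc u x -> ~~ connect arc h x -> connect cut_arc u x.
Proof.
case/connectP => s; elim: s u => [|z s IH] u /=; first by move=> _ ->.
case/andP => uz zs lx hx; apply: (@connect_trans _ _ z); last exact: IH.
apply: connect1; rewrite /cut_arc uz /=; apply: contra hx => /andP[_ /eqP <-].
by apply/connectP; exists s.
Qed.

Lemma below_h x : connect arc h x -> x = h \/ x = v0.
Proof.
case/connect_first => [->|[z]]; first by left.
by rewrite children_h => /eqP-> /(connect_leaf leaf_v0)->; right.
Qed.

Lemma h_not_leaf : ~~ leaf arc h.
Proof. by apply/negP => /leafP/(_ v0); rewrite children_h eqxx. Qed.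

Lemma h_not_above x : x != v -> ~~ connect arc h (f x).
Proof.
move=> xv; apply/negP => /below_h[E|].
  by have := h_not_leaf; rewrite -E f_leaf.
by rewrite -fv => /f_inj E; rewrite E eqxx in xv.
Qed.

Lemma h_not_above_parent u : arc u h -> ~~ connect arc h u.
Proof. exact: acy. Qed.

Lemma above_v0 u : connect arc u v0 ->
  [\/ u = v0, u = h, connect arc u p | connect arc u q].
Proof.
have hv0 : arc h v0 by rewrite children_h.
have v0h : v0 != h by apply: contraTneq leaf_v0 => ->; exact: h_not_leaf.
case/connect_last => [|[z uz zv0]]; first by constructor 1.
move: uz; rewrite (tree_vertex v0h zv0 hv0) => /connect_last[|[y uy]]; first by constructor 2.
by rewrite parents_h => /orP[] /eqP <-; [constructor 3 | constructor 4].
Qed.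

(* Removing the arc from q to h leaves a tree, in which the leaves other than v
   keep their ancestors while v loses those ancestors that lie above q only. *)
Lemma side_cograph (A : {set T}) :
  (forall x w, x \in A -> x != v -> connect arc w (f x) -> connect arc w q -> w = rho) ->
  cograph_on e A.
Proof.
move=> side.
have ph : cut_arc p h by rewrite /cut_arc parents_h eqxx (negbTE pq).
have hv0 : cut_arc h v0.
  rewrite /cut_arc children_h eqxx /=; apply/negP => /andP[_ /eqP E].
  by have := h_not_leaf; rewrite -E leaf_v0.
have p_v u : connect arc u p -> connect cut_arc u (f v).
  move=> up; apply: connect_trans (connect_trans (connect1 ph) _); last by rewrite fv connect1.
  by apply: cut_connect up _; apply: h_not_above_parent; rewrite parents_h eqxx.
(* If [y] is [v], then [side] prevents [w] from lying above [q], so [w] lies above [p] and reaches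
   [v] without the deleted arc. *)
have up x y w : x \in A -> x != v -> w != rho -> connect arc w (f x) -> connect arc w (f y) ->
    connect cut_arc w (f y).
  move=> xA xv wrho wx; case: (eqVneq y v) => [->|yv] wy; last first.
    by apply: cut_connect wy _; apply: h_not_above.
  have nh : w != h by apply: contraTneq wx => ->; apply: h_not_above.
  move: wy; rewrite {1}fv => /above_v0[E|E|/p_v//|wq].
  - move: wx; rewrite E => /(connect_leaf leaf_v0); rewrite -fv => /f_inj E'.
    by rewrite E' eqxx in xv.
  - by rewrite E eqxx in nh.
  - by have := side x w xA xv wx wq => E; rewrite E eqxx in wrho.
apply: (@forest_cograph _ _ e cut_arc t f A rho) => //.
- exact: cut_acyclic.
- exact: cut_unique_parents.
- move=> x xA; case: (eqVneq x v) => [->|xv]; first exact: p_v.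
  by apply: cut_connect => //; apply: h_not_above.
(* A lowest common ancestor in the cut tree is one in the network: a lower [w'] in the network is
   not [rho], and one of [x], [y] is not [v], so by [up] it is a common ancestor in the cut tree
   too. *)
move=> x y w xA yA xy [wx [wy low]]; apply: expl => //.
split; [exact: cut_sub | split; [exact: cut_sub|]] => w' nw ww'.
apply/negP => /andP[w'x w'y].
have w'rho : w' != rho.
  by apply: contraNneq nw => E; move: ww'; rewrite E => /(connect_source rho_src) ->.
have [z [zA zv w'z]] : exists z, [/\ z \in A, z != v & connect arc w' (f z)].
  case: (eqVneq x v) => [xv|xv]; last by exists x.
  by exists y; split=> //; rewrite eq_sym -xv.
have cww' : connect cut_arc w w'.
  apply: cut_connect ww' _; apply: contra (h_not_above zv) => hw'.
  exact: connect_trans hw' w'z.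
by have := low w' nw cww'; rewrite !(up z) // ?w'x ?w'y.
Qed.

End Unicyclic.

Lemma network_pseudo_cograph (T : finType) (e : rel T)
    (V : finType) (arc : rel V) (t : V -> label) (C : {set V}) (h : V) :
  symmetric e -> irreflexive e ->
  level1 arc -> explains e arc t -> is_cycle arc C ->
  (forall C' : {set V}, is_cycle arc C' -> C' = C) ->
  (forall rho : V, net_root arc rho -> cycle_root arc C rho) ->
  cycle_hybrid arc C h -> outdeg arc h = 1 -> (forall c, arc h c -> leaf arc c) ->
  pseudo_cograph e.
Proof.
move=> es ei [[acy net] lev] [f [f_inj f_leaf f_surj expl]] [bC C2] uniqC rootC [hC hyb] out1 hleaf.
case: net => [[V1 _]|[rho [rho0 _ net]]].
  by have := leq_trans C2 (max_card (mem C)); rewrite V1.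
have rho_src := indeg_eq0 rho0.
have par x : x != rho -> exists u, arc u x.
  move=> xr; have /card_gt0P[u] : 0 < indeg arc x by case: (net x xr) => -[-> _].
  by rewrite inE => ux; exists u.
have rho_top := root_reaches_all acy par.
have [rhoC _] := rootC rho rho0.
(* Two parents would put [x] on a cycle, which can only be [C]; then [x] and [h] are hybrid-vertices
   of the same component and coincide. *)
have tree_vertex x u u' : x != h -> arc u x -> arc u' x -> u = u'.
  move=> xh ux u'x; apply/eqP; apply: contraNT xh => uu'.
  have xrho : x != rho by apply: contraTneq ux => ->.
  have hx : hybrid arc x.
    have : 1 < indeg arc x by apply/card_gt1P; exists u, u'; rewrite !inE.
    by rewrite /hybrid; case: (net x xrho) => -[-> _].
  have Pr : connect arc rho u && connect arc rho u' by rewrite !rho_top.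
  have [w [/andP[wu wu'] low]] :=
    acyclic_lowest acy (P := fun w => connect arc w u && connect arc w u') Pr.
  have [|B [bB _ xB B2]] := two_parents_biconnected acy uu' ux u'x (w := w); first by [].
  have [C' bC' BC'] := bicomponent_exists bB.
  have C'C : C' = C.
    by apply: uniqC; split=> //; apply: leq_trans B2 (subset_leq_card BC').
  have xC : x \in C by rewrite -C'C (subsetP BC').
  by apply/eqP; apply: (card_le1_eqP (lev C bC)); rewrite inE ?xC ?hC.
have [p1 [p2 [p12 hp]]] : exists p1 p2, p1 != p2 /\ forall u, arc u h = (u == p1) || (u == p2).
  have /cards2P[p1 [p2 [p12 E]]] := hyb.
  by exists p1, p2; split=> // u; have /setP/(_ u) := E; rewrite !inE.
have [v0 hv0] : exists v0, forall c, arc h c = (c == v0).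
  have /eqP/cards1P[v0 E] := out1.
  by exists v0 => c; have /setP/(_ c) := E; rewrite !inE.
have leaf_v0 : leaf arc v0 by apply: hleaf; rewrite hv0.
have [v fv] := f_surj v0 leaf_v0.
have ph1 : arc p1 h by rewrite hp eqxx.
have ph2 : arc p2 h by rewrite hp eqxx orbT.
(* Otherwise u would separate rho from h within C. *)
have apart u : connect arc u p1 -> connect arc u p2 -> u = rho.
  move=> u1 u2; apply/eqP; case: (eqVneq u rho) => // urho.
  have uh : u != h by apply/eqP => E; have := acy _ _ ph1; rewrite -E u1.
  (* Being below [u] passes along these edges in both directions: both parents of [h] are below [u],
     and any other vertex strictly below [u] has its only parent below [u]. *)
  have uconn a b : uadj_in arc (C :\ u) a b -> connect arc u a = connect arc u b.
    have down a' b' : a' != u -> b' != u -> arc a' b' -> connect arc u a' = connect arc u b'.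
      move=> au bu ab; apply/idP/idP => [ua|/connect_last[E|[z uz zb]]].
      - exact: connect_trans ua (connect1 ab).
      - by rewrite E eqxx in bu.
      case: (eqVneq b' h) ab => [->|bh ab]; last by rewrite (tree_vertex _ _ _ bh ab zb).
      by rewrite hp => /orP[] /eqP->.
    case/and3P => /setD1P[au _] /setD1P[bu _] /orP[] ab; first exact: down.
    by apply/esym/down.
  have hc := @uconnected_setD1 _ _ _ u (proj1 bC) rho h.
  rewrite !inE rhoC hC eq_sym urho eq_sym uh in hc.
  have := closed_connect (a := fun z => connect arc u z) uconn (hc isT isT).
  rewrite /in_mem /= (connect_trans u1 (connect1 ph1)) => ur.
  by rewrite (connect_source rho_src ur) eqxx in urho.
pose S x := [exists u, [&& u != rho, connect arc u (f x) & connect arc u p2]].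
pose S2 := [set x | (x != v) && S x].
pose S1 := [set x | (x != v) && ~~ S x].
(* No path to a leaf other than that of [v] passes through [h], so its ancestors are those in a cut
   tree. *)
have chain x u u' : x != v -> connect arc u (f x) -> connect arc u' (f x) ->
    connect arc u u' || connect arc u' u.
  move=> xv ux u'x.
  have nh := h_not_above hv0 leaf_v0 f_inj f_leaf fv xv.
  case/orP: (ancestors_chain (cut_unique_parents hp tree_vertex)
    (cut_connect p2 ux nh) (cut_connect p2 u'x nh)) => /cut_sub->; rewrite ?orbT //.
have cog1 : cograph_on e (v |: S1).
  apply: (side_cograph es ei acy rho_src rho_top p12 hp tree_vertex hv0 leaf_v0 f_inj f_leaf fv expl).
  move=> x w; rewrite !inE => /predU1P[->|/andP[_ nS] _ wx wq]; first by rewrite eqxx.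
  apply/eqP/negPn/negP => wr; case/negP: nS; apply/existsP; exists w.
  by rewrite wr wx wq.
(* Now the arc from [p1] is cut. An ancestor [w] of [x] above [p1] is comparable with the vertex [u]
   that puts [x] into [S2]; the higher one is above both parents, hence is [rho] by [apart], and so
   it is not [u]. *)
have cog2 : cograph_on e (v |: S2).
  have hp' u : arc u h = (u == p2) || (u == p1) by rewrite hp orbC.
  have p21 : p2 != p1 by rewrite eq_sym.
  apply: (side_cograph es ei acy rho_src rho_top p21 hp' tree_vertex hv0 leaf_v0 f_inj f_leaf fv expl).
  move=> x w; rewrite !inE => /predU1P[->|/andP[xv]]; first by rewrite eqxx.
  case/existsP => u /and3P[urho ux up2] _ wx wp1; case/orP: (chain x u w xv ux wx) => uw.
    by have E := apart u (connect_trans uw wp1) up2; rewrite E eqxx in urho.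
  exact: apart w wp1 (connect_trans uw up2).
(* A common ancestor [w] other than [rho] is comparable with the vertex [u] that puts [y] into [S2];
   the higher of the two would put [x] into [S2] as well. *)
have cross x y : x \in S1 -> y \in S2 -> (e x y <-> t rho = L1).
  rewrite !inE => /andP[xv nS] /andP[yv Sy]; apply: expl.
    by apply: contraNneq nS => ->.
  split=> //; split=> // w wr _; apply/negP => /andP[wx wy].
  case/existsP: Sy => u /and3P[urho uy up2]; case/negP: nS; apply/existsP.
  case/orP: (chain y u w yv uy wy) => uw.
    by exists u; rewrite urho (connect_trans uw wx).
  by exists w; rewrite wr wx (connect_trans uw up2).
have vS1 : v \notin S1 by rewrite inE eqxx.
have vS2 : v \notin S2 by rewrite inE eqxx.
have [E2|n2] := eqVneq S2 set0.
  apply: cograph_pseudo_cograph => //; suff <- : v |: S1 = [set: T] by [].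
  apply/setP => x; have := in_set0 x; rewrite -E2 !inE.
  by case: (x == v) => //= ->.
have [E1|n1] := eqVneq S1 set0.
  apply: cograph_pseudo_cograph => //; suff <- : v |: S2 = [set: T] by [].
  apply/setP => x; have := in_set0 x; rewrite -E1 !inE.
  by case: (x == v) => //= /negbFE ->.
right; exists (v |: S1), (v |: S2), v; split.
- by apply/setP => x; rewrite !inE; case: (x == v); case: (S x).
- by apply/setP => x; rewrite !inE; case: (x == v); case: (S x).
- by rewrite !cardsU1 vS1 vS2 !add1n !ltnS !card_gt0.
- by [].
rewrite !setU1K //; have [tr|tr] : t rho = L1 \/ t rho <> L1.
  by case: (t rho); [right|left|right].
  by left=> x y x1 y2; apply/(cross x y).
by right=> x y x1 y2; apply/negP => /(cross x y x1 y2).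
Qed.

(** * Cotrees and their gluing *)

(** A rooted tree that explains the graph on [A], with its leaves indexed by [A] through [f], whose
    values outside [A] are free. The branching condition forbids single children and admits the
    one-vertex tree. *)
Record cotree (T : finType) (e : rel T) (A : {set T}) (V : finType) (arc : rel V) (r : V)
    (t : V -> label) (f : T -> V) : Prop := Cotree {
  cotree_acyclic : acyclic arc;
  cotree_source : forall u, ~~ arc u r;
  cotree_parent : forall x, x != r -> exists u, arc u x;
  cotree_unique : unique_parents arc;
  cotree_branching : forall x y, arc x y -> exists2 y', y' != y & arc x y';
  cotree_leaf : forall x, leaf arc x <-> exists2 a, a \in A & f a = x;
  cotree_inj : {in A &, injective f};
  cotree_label : labeling arc t;
  cotree_expl : forall x y w, x \in A -> y \in A -> x != y -> is_lca arc (f x) (f y) w ->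
    (e x y <-> t w = L1)
}.

Section Glue.
Variables (V1 V2 : finType) (arc1 : rel V1) (arc2 : rel V2) (r1 v1 : V1) (r2 v2 : V2).
Variable (h : bool).

(* A new root [None] is put above both trees. When [h] holds, the leaf [v2] is
   moreover turned into a hybrid-vertex, whose parents are those of [v1] and [v2]
   and whose only child is [v1]. *)
Definition glue_arc : rel (option (V1 + V2)) := fun u w =>
  match u, w with
  | None, Some (inl b) => b == r1
  | None, Some (inr b) => b == r2
  | Some (inl a), Some (inl b) => arc1 a b && ~~ (h && (b == v1))
  | Some (inl a), Some (inr b) => [&& h, b == v2 & arc1 a v1]
  | Some (inr a), Some (inr b) => arc2 a b
  | Some (inr a), Some (inl b) => [&& h, a == v2 & b == v1]
  | _, None => false
  end.

(** Closed form of reachability after gluing. The second tree is entered from the first only at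
    [v2], from strict ancestors of [v1]; the first is entered from the second only at [v1], through
    [v2]. *)
Definition glue_anc : rel (option (V1 + V2)) := fun u w =>
  match u, w with
  | None, _ => true
  | Some _, None => false
  | Some (inl a), Some (inl b) => connect arc1 a b
  | Some (inl a), Some (inr b) => [&& h, b == v2, a != v1 & connect arc1 a v1]
  | Some (inr a), Some (inr b) => connect arc2 a b
  | Some (inr a), Some (inl b) => [&& h, b == v1 & connect arc2 a v2]
  end.

Hypotheses (acy1 : acyclic arc1) (acy2 : acyclic arc2).
Hypotheses (top1 : forall x, connect arc1 r1 x) (top2 : forall x, connect arc2 r2 x).
Hypotheses (leaf1 : h -> leaf arc1 v1) (leaf2 : h -> leaf arc2 v2).
Hypotheses (r1v1 : h -> r1 != v1).

Lemma glue_connect u w : connect glue_arc u w = glue_anc u w.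
Proof.
apply/idP/idP => [/connectP[p]|].
  elim: p u => [|x p IH] u /=.
    by move=> _ ->; case: u => [[a|a]|] //=; apply: connect0.
  case/andP => ux xp lw; have := IH x xp lw; move: ux {IH xp lw}.
  case: u x w => [[a|a]|] // [[b|b]|] // [[c|c]|] //=.
  - by case/andP => ab _; apply: connect_trans (connect1 ab).
  - case/andP => ab _ /and4P[hh -> bv bv1]; rewrite hh (connect_trans (connect1 ab) bv1) andbT /=.
    by apply: contraTneq ab => ->; apply/leafP/leaf1.
  - by case/and3P => hh /eqP-> ab /and3P[_ /eqP-> _]; apply: connect1.
  - case/and3P => hh /eqP-> ab /(connect_leaf (leaf2 hh))->; rewrite hh eqxx connect1 // andbT /=.
    by apply: contraTneq ab => ->; apply/leafP/leaf1.
  - case/and3P => hh /eqP-> /eqP->  /(connect_leaf (leaf1 hh))->.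
    by rewrite hh eqxx connect0.
  - by case/and3P => hh /eqP-> /eqP-> /and4P[_ _]; rewrite eqxx.
  - by move=> ab /and3P[-> -> bv]; rewrite (connect_trans (connect1 ab)).
  - by move=> ab; apply: connect_trans (connect1 ab).
have c1 a b : connect arc1 a b -> connect glue_arc (Some (inl a)) (Some (inl b)).
  case/connectP => p; elim: p a => [|x p IH] a /=; first by move=> _ ->.
  case/andP => ax xp lw; apply: (@connect_trans _ _ (Some (inl x))); last exact: IH.
  (* An arc into [v1] is replaced by the detour through the hybrid-vertex [v2]. *)
  have [/andP[hh /eqP E]|nx] := boolP (h && (x == v1)); last by apply: connect1; rewrite /= ax.
  apply: (@connect_trans _ _ (Some (inr v2))); apply: connect1; rewrite /= hh eqxx //.
    by rewrite -E.
  by rewrite E eqxx.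
have c2 a b : connect arc2 a b -> connect glue_arc (Some (inr a)) (Some (inr b)).
  case/connectP => p; elim: p a => [|x p IH] a /=; first by move=> _ ->.
  case/andP => ax xp lw; apply: (@connect_trans _ _ (Some (inr x))); last exact: IH.
  exact: connect1.
case: u w => [[a|a]|] // [[b|b]|] //=.
- exact: c1.
- case/and4P => hh /eqP-> av /connect_last[E|[z az zv]]; first by rewrite E eqxx in av.
  by apply: connect_trans (c1 _ _ az) (connect1 _); rewrite /= hh eqxx.
- case/and3P => hh /eqP-> /c2 av; apply: connect_trans av (connect1 _).
  by rewrite /= hh !eqxx.
- exact: c2.
- by move=> _; apply: connect_trans (c1 _ _ (top1 b)); apply: connect1; rewrite /=.
- by move=> _; apply: connect_trans (c2 _ _ (top2 b)); apply: connect1; rewrite /=.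
Qed.

Lemma glue_acyclic : acyclic glue_arc.
Proof.
move=> x y; rewrite glue_connect; case: x y => [[a|a]|] [[b|b]|] //=.
- by case/andP => /acy1.
- by case/and3P => hh _ av; apply: contraTN av => /and3P[_ /eqP-> _]; apply/leafP/leaf1.
- by case/and3P => hh _ /eqP->; rewrite eqxx !andbF.
- exact: acy2.
Qed.

Lemma glue_leafl a : leaf glue_arc (Some (inl a)) = leaf arc1 a.
Proof.
apply/leafP/leafP => H.
  move=> b; apply/negP => ab; have := H (Some (inl b)); rewrite /= ab /= negbK => /andP[hh /eqP E].
  by have := H (Some (inr v2)); rewrite /= hh eqxx -E ab.
by case=> [[b|b]|] //=; rewrite (negbTE (H _)) ?andbF.
Qed.

Lemma glue_leafr a : leaf glue_arc (Some (inr a)) = leaf arc2 a && ~~ (h && (a == v2)).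
Proof.
apply/leafP/andP => [H|[/leafP H n]].
  split; first by apply/leafP => b; apply: (H (Some (inr b))).
  by have := H (Some (inl v1)); rewrite /= eqxx andbT.
case=> [[b|b]|] //=; by move: n; case: h; case: eqP.
Qed.

Lemma glue_leaf_root : ~~ leaf glue_arc None.
Proof. by apply/negP => /leafP/(_ (Some (inl r1))); rewrite /= eqxx. Qed.

Lemma glue_parent x : (forall y, y != r1 -> exists u, arc1 u y) ->
  (forall y, y != r2 -> exists u, arc2 u y) -> x != None -> exists u, glue_arc u x.
Proof.
move=> p1 p2; case: x => [[a|a]|] // _.
  have [/andP[hh /eqP->]|n] := boolP (h && (a == v1)).
    by exists (Some (inr v2)); rewrite /= hh !eqxx.
  have [->|/p1[u ua]] := eqVneq a r1; first by exists None; rewrite /=.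
  by exists (Some (inl u)); rewrite /= ua.
have [->|/p2[u ua]] := eqVneq a r2; first by exists None; rewrite /=.
by exists (Some (inr u)).
Qed.

Lemma glue_unique_parents u u' x :
  unique_parents arc1 -> unique_parents arc2 ->
  (forall u, ~~ arc1 u r1) -> (forall u, ~~ arc2 u r2) ->
  ~~ (h && (x == Some (inr v2))) ->
  glue_arc u x -> glue_arc u' x -> u = u'.
Proof.
move=> up1 up2 s1 s2; case: x => [[a|a]|] nx.
- case: u u' => [[b|b]|] [[c|c]|] //=.
  + by case/andP => ba _ /andP[ca _]; rewrite (up1 _ _ _ ba ca).
  + by case/andP => _ /negP n /and3P[hh _ av]; case: n; rewrite hh.
  + by case/andP => ba _ /eqP E; rewrite E (negbTE (s1 b)) in ba.
  + by case/and3P => hh _ av /andP[_ /negP[]]; rewrite hh.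
  + by case/and3P => _ /eqP-> _ /and3P[_ /eqP-> _].
  + by case/and3P => hh _ /eqP-> /eqP E; have := r1v1 hh; rewrite E eqxx.
  + by move/eqP->; rewrite (negbTE (s1 c)).
  + by move/eqP-> => /and3P[hh _]; rewrite (negbTE (r1v1 hh)).
- have n b : ~~ glue_arc (Some (inl b)) (Some (inr a)).
    by rewrite /=; apply/negP => /and3P[hh /eqP E _]; rewrite hh E eqxx in nx.
  case: u u' => [[b|b]|] [[c|c]|]; rewrite ?(negbTE (n _)) //=.
  + by move=> ba ca; rewrite (up2 _ _ _ ba ca).
  + by move=> ba /eqP E; rewrite E (negbTE (s2 b)) in ba.
  + by move/eqP->; rewrite (negbTE (s2 c)).
by case: u => [[]|].
Qed.

Lemma glue_branching x y :
  (forall x y, arc1 x y -> exists2 y', y' != y & arc1 x y') ->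
  (forall x y, arc2 x y -> exists2 y', y' != y & arc2 x y') ->
  ~~ (h && (x == Some (inr v2))) ->
  glue_arc x y -> exists2 y', y' != y & glue_arc x y'.
Proof.
move=> b1 b2; case: x => [[a|a]|] nx.
(* [k] sends each old child of [a] to its new child, redirecting [v1] to [v2]; being injective, it
   preserves the number of children. *)
- pose k b : option (V1 + V2) := if h && (b == v1) then Some (inr v2) else Some (inl b).
  have k_inj : injective k.
    move=> b c; rewrite /k; case: ifP => [/andP[_ /eqP->]|_]; case: ifP => [/andP[_ /eqP->]|_] //.
    by case.
  have k_arc b : glue_arc (Some (inl a)) (k b) = arc1 a b.
    rewrite /k; case: ifP => [/andP[hh /eqP->]|n] /=; first by rewrite hh eqxx.
    by rewrite n andbT.
  have k_im : glue_arc (Some (inl a)) y -> exists2 b, y = k b & arc1 a b.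
    case: y => [[b|b]|] //=; first by case/andP => ab n; exists b; rewrite // /k (negbTE n).
    by case/and3P => hh /eqP-> av; exists v1; rewrite // /k hh eqxx.
  case/k_im => b -> /b1[b' bb' ab']; exists (k b'); rewrite ?k_arc //.
  by rewrite (inj_eq k_inj).
- case: y => [[b|b]|] //=; first by case/and3P => hh /eqP E; rewrite hh E eqxx in nx.
  by case/b2 => b' bb' ab'; exists (Some (inr b')).
case: y => [[b|b]|] //= _; first by exists (Some (inr r2)); rewrite //=.
by exists (Some (inl r1)); rewrite //=.
Qed.

End Glue.

(** * Labels and leaves of the glued cotrees *)

Section GlueCotrees.
Variables (T : finType) (e : rel T) (A1 A2 : {set T}) (V1 V2 : finType).
Variables (arc1 : rel V1) (arc2 : rel V2) (r1 v1 : V1) (r2 v2 : V2).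
Variables (t1 : V1 -> label) (t2 : V2 -> label) (f1 : T -> V1) (f2 : T -> V2).
Variables (h : bool) (v : T) (l : label).
Hypotheses (esym : symmetric e).
Hypotheses (ct1 : cotree e A1 arc1 r1 t1 f1) (ct2 : cotree e A2 arc2 r2 t2 f2).
Hypothesis hv : h -> [/\ v \in A1, v \in A2, f1 v = v1 & f2 v = v2].
Hypothesis cap : forall x, x \in A1 -> x \in A2 -> h /\ x = v.
Hypothesis r1v1 : h -> r1 != v1.
Hypothesis l_dot : l <> Lodot.
Hypothesis cross : forall x y, x \in A1 -> x \notin A2 -> y \in A2 -> y \notin A1 ->
  (e x y <-> l = L1).

Local Notation garc := (glue_arc arc1 arc2 r1 v1 r2 v2 h).

(** The hybrid-vertex [v2] was a leaf and needs a new label. The choice [L0] is arbitrary, because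
    only one leaf lies below it. *)
Definition glue_label (w : option (V1 + V2)) : label :=
  match w with
  | None => l
  | Some (inl a) => t1 a
  | Some (inr a) => if h && (a == v2) then L0 else t2 a
  end.

(** A shared vertex is sent to its leaf in the first tree, the one that hangs below the
    hybrid-vertex. *)
Definition glue_map (x : T) : option (V1 + V2) :=
  if x \in A1 then Some (inl (f1 x)) else Some (inr (f2 x)).

Let top1 := root_reaches_all (cotree_acyclic ct1) (cotree_parent ct1).
Let top2 := root_reaches_all (cotree_acyclic ct2) (cotree_parent ct2).

Lemma hybrid_leaf1 : h -> leaf arc1 v1.
Proof. by case/hv => vA _ <- _; apply/(cotree_leaf ct1); exists v. Qed.

Lemma hybrid_leaf2 : h -> leaf arc2 v2.
Proof. by case/hv => _ vA _ <-; apply/(cotree_leaf ct2); exists v. Qed.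

Lemma glue_cotrees_connect u w :
  connect garc u w = glue_anc arc1 arc2 v1 v2 h u w.
Proof. exact: glue_connect top1 top2 hybrid_leaf1 hybrid_leaf2 _ _. Qed.

Lemma glue_cotrees_acyclic : acyclic garc.
Proof.
exact: glue_acyclic (cotree_acyclic ct1) (cotree_acyclic ct2) top1 top2 hybrid_leaf1 hybrid_leaf2.
Qed.

Lemma glue_labeling : labeling garc glue_label.
Proof.
case=> [[a|a]|] /=.
- by rewrite glue_leafl; apply: (cotree_label ct1).
- rewrite glue_leafr; case: ifP => _; first by rewrite andbF.
  by rewrite andbT; apply: (cotree_label ct2).
by split=> // nl; have := glue_leaf_root arc1 arc2 r1 v1 r2 v2 h; rewrite nl.
Qed.

Lemma glue_map_leaf w : leaf garc w <-> exists2 x, x \in A1 :|: A2 & glue_map x = w.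
Proof.
case: w => [[a|a]|].
- rewrite glue_leafl; split=> [/(cotree_leaf ct1)[x xA <-]|[x _]].
    by exists x; rewrite ?inE ?xA // /glue_map xA.
  rewrite /glue_map; case: ifP => // xA [<-]; apply/(cotree_leaf ct1).
  by exists x.
- rewrite glue_leafr; split=> [/andP[/(cotree_leaf ct2)[x xA <-] n]|[x]].
    exists x; rewrite ?inE ?xA ?orbT // /glue_map; case: ifP => // xA1.
    have [hh E] := cap xA1 xA; have [_ _ _ f2v] := hv hh.
    by rewrite hh E f2v eqxx in n.
  rewrite /glue_map inE; case: ifP => // xA1 /= xA2 [<-]; apply/andP; split.
    by apply/(cotree_leaf ct2); exists x.
  apply/negP => /andP[/hv[vA1 vA2 _ <-]] /eqP /(cotree_inj ct2 xA2 vA2) E.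
  by rewrite E vA1 in xA1.
split=> [nl|[x _]]; first by have := glue_leaf_root arc1 arc2 r1 v1 r2 v2 h; rewrite nl.
by rewrite /glue_map; case: ifP.
Qed.

Lemma glue_map_inj : {in A1 :|: A2 &, injective glue_map}.
Proof.
move=> x y; rewrite !inE /glue_map; case: ifP => xA; case: ifP => yA //= xA2 yA2 [].
  exact: (cotree_inj ct1).
exact: (cotree_inj ct2).
Qed.

Lemma glue_explains x y w : x \in A1 :|: A2 -> y \in A1 :|: A2 -> x != y ->
  is_lca garc (glue_map x) (glue_map y) w -> (e x y <-> glue_label w = L1).
Proof.
have mixed x' y' : x' \in A1 -> y' \notin A1 -> y' \in A2 -> x' != y' ->
    is_lca garc (glue_map x') (glue_map y') w -> (e x' y' <-> glue_label w = L1).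
  move=> xA1 yA1 yA2 xy [wx [wy low]].
  have f2yv : h -> f2 y' != v2.
    case/hv => vA1 vA2 _ <-; apply/negP => /eqP /(cotree_inj ct2 yA2 vA2) E.
    by rewrite E vA1 in yA1.
  move: wx wy low; rewrite /glue_map xA1 (negbTE yA1) !glue_cotrees_connect.
  (* If [x'] is [v], the hybrid-vertex stands for it, and the lowest common ancestor is found in the
     second tree; otherwise it is the new root. *)
  have [xA2|xA2] := boolP (x' \in A2).
    have [hh xv] := cap xA1 xA2; have [_ _ fv1 fv2] := hv hh.
    case: w => [[a|a]|] /=; first by rewrite hh (negbTE (f2yv hh)).
      case/and3P => _ _ av ay low.
      have av2 : a != v2.
        by apply: contraTneq ay => ->; apply: contra (f2yv hh) => /(connect_leaf (hybrid_leaf2 hh))->.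
      rewrite (negbTE av2) andbF; apply: (cotree_expl ct2) => //.
      split; first by rewrite xv fv2.
      split=> // a' na aa'; apply/negP => /andP[a'x a'y].
      have := low (Some (inr a')); rewrite !glue_cotrees_connect /= hh xv fv1 eqxx /=.
      by rewrite -fv2 -xv a'x a'y aa' => /(_ na isT).
    move=> _ _ /(_ (Some (inr r2))); rewrite !glue_cotrees_connect /= hh xv fv1 eqxx.
    by rewrite !top2 => /(_ isT isT).
  case: w => [[a|a]|] /=.
  - by move=> _ /and3P[hh]; rewrite (negbTE (f2yv hh)).
  - case/and3P => hh /eqP fx; have [vA1 vA2 fv1 _] := hv hh.
    have E : x' = v by apply: (cotree_inj ct1) => //; rewrite fv1.
    by rewrite E vA2 in xA2.
  by move=> _ _ _; apply: cross.
move=> xA yA xy lca; have [xA1|xA1] := boolP (x \in A1); have [yA1|yA1] := boolP (y \in A1).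
- move: lca; rewrite /is_lca /glue_map xA1 yA1 !glue_cotrees_connect => -[wx [wy low]].
  case: w {mixed} wx wy low => [[a|a]|] /=.
  + move=> ax ay low; apply: (cotree_expl ct1) => //; split=> //; split=> // a' na aa'.
    by have := low (Some (inl a')); rewrite !glue_cotrees_connect /= aa' => /(_ na isT).
  + case/and3P => _ /eqP fx _ /and3P[_ /eqP fy _] _; rewrite -fx in fy.
    by rewrite (cotree_inj ct1 yA1 xA1 fy) eqxx in xy.
  move=> _ _ /(_ (Some (inl r1))); rewrite !glue_cotrees_connect /= !top1.
  by move=> /(_ isT isT).
- by move: yA; rewrite inE (negbTE yA1) => yA2; apply: mixed.
- move: xA; rewrite inE (negbTE xA1) => xA2; rewrite esym; apply: mixed => //.
    by rewrite eq_sym.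
  case: lca => wx [wy low]; split=> //; split=> // w' nw ww'.
  by rewrite andbC; apply: low.
move: xA yA; rewrite !inE (negbTE xA1) (negbTE yA1) /= => xA2 yA2.
move: lca; rewrite /is_lca /glue_map (negbTE xA1) (negbTE yA1) !glue_cotrees_connect => -[wx [wy low]].
case: w {mixed} wx wy low => [[a|a]|] /=.
- case/and4P => _ /eqP fx _ _ /and4P[_ /eqP fy _ _] _; rewrite -fx in fy.
  by rewrite (cotree_inj ct2 yA2 xA2 fy) eqxx in xy.
- move=> ax ay low; case: ifP => [/andP[hh /eqP E]|_].
    move: ax ay; rewrite E => /(connect_leaf (hybrid_leaf2 hh)) fx /(connect_leaf (hybrid_leaf2 hh)) fy.
    by rewrite -fx in fy; rewrite (cotree_inj ct2 yA2 xA2 fy) eqxx in xy.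
  apply: (cotree_expl ct2) => //; split=> //; split=> // a' na aa'.
  by have := low (Some (inr a')); rewrite !glue_cotrees_connect /= aa' => /(_ na isT).
move=> _ _ /(_ (Some (inr r2))); rewrite !glue_cotrees_connect /= !top2.
by move=> /(_ isT isT).
Qed.

End GlueCotrees.

(** With [h] false the gluing only adds a root above two disjoint trees; [r1] and [r2] are
    placeholders for the shared leaf. *)
Lemma cotree_join (T : finType) (e : rel T) (A1 A2 : {set T}) (V1 V2 : finType)
    (arc1 : rel V1) (arc2 : rel V2) r1 r2 t1 t2 f1 f2 l :
  symmetric e -> cotree e A1 arc1 r1 t1 f1 -> cotree e A2 arc2 r2 t2 f2 ->
  A1 != set0 -> A1 :&: A2 = set0 -> l <> Lodot ->
  (forall x y, x \in A1 -> y \in A2 -> (e x y <-> l = L1)) ->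
  cotree e (A1 :|: A2) (glue_arc arc1 arc2 r1 r1 r2 r2 false) None
    (glue_label r2 t1 t2 false l) (glue_map A1 f1 f2).
Proof.
move=> es ct1 ct2 /set0Pn[v _] I0 ll X.
have hv : false -> [/\ v \in A1, v \in A2, f1 v = r1 & f2 v = r2] by [].
have cap x : x \in A1 -> x \in A2 -> false /\ x = v.
  by move=> x1 x2; have := in_set0 x; rewrite -I0 inE x1 x2.
split.
- exact: (glue_cotrees_acyclic ct1 ct2 hv).
- by case=> [[]|].
- by move=> x; apply: glue_parent; [exact: cotree_parent ct1 | exact: cotree_parent ct2].
- move=> u u' x; apply: glue_unique_parents => //.
  + exact: cotree_unique ct1.
  + exact: cotree_unique ct2.
  + exact: cotree_source ct1.
  + exact: cotree_source ct2.
- move=> x y; apply: glue_branching => //.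
  + exact: cotree_branching ct1.
  + exact: cotree_branching ct2.
- exact: (glue_map_leaf ct1 ct2 hv cap).
- exact: glue_map_inj ct1 ct2.
- exact: (glue_labeling _ _ _ ct1 ct2 ll).
move=> x y w; apply: (glue_explains es ct1 ct2 hv cap) => // a b aA _ bA _; exact: X.
Qed.

Lemma cotree_single (T : finType) (e : rel T) (x : T) :
  cotree e [set x] (fun _ _ : unit => false) tt (fun=> Lodot) (fun=> tt).
Proof.
split=> //.
- case; split=> [_|_]; first by exists x; rewrite ?inE.
  exact/leafP.
- by move=> a b /set1P-> /set1P->.
- by case; split=> // _; apply/leafP.
by move=> a b w /set1P-> /set1P->; rewrite eqxx.
Qed.

(** Strong induction along [cograph_decomposable]; the new root is labeled [L1] for a join and [L0]
    for a disjoint union. *)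
Lemma cotree_exists (T : finType) (e : rel T) (A : {set T}) :
  symmetric e -> irreflexive e -> A != set0 -> cograph_on e A ->
  exists (V : finType) (arc : rel V) r t f, cotree e A arc r t f.
Proof.
move=> es ei; have [n] := ubnP #|A|; elim: n A => // n IH A /ltnSE An A0 cA.
have [A1|A1] := ltnP 1 #|A|; last first.
  have /cards1P[x ->] : #|A| == 1 by rewrite eqn_leq A1 card_gt0.
  exists unit, (fun _ _ => false), tt, (fun=> Lodot), (fun=> tt); exact: cotree_single.
have [B1 [B2 [n1 n2 I0 U X]]] := cograph_decomposable es ei A1 cA.
have cU : #|A| = #|B1| + #|B2| by rewrite -U cardsU I0 cards0 subn0.
have small (B : {set T}) : B \subset A -> B != set0 -> #|B| < n ->
    exists (V : finType) (arc : rel V) r t f, cotree e B arc r t f.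
  by move=> BA B0 Bn; apply: IH => //; apply: cograph_on_sub BA cA.
have [|||V1 [a1 [r1 [t1 [f1 ct1]]]]] := small B1 => //.
- by rewrite -U subsetUl.
- by apply: leq_trans An; rewrite cU -addn1 leq_add2l card_gt0.
have [|||V2 [a2 [r2 [t2 [f2 ct2]]]]] := small B2 => //.
- by rewrite -U subsetUr.
- by apply: leq_trans An; rewrite cU -add1n leq_add2r card_gt0.
have [l ll lX] : exists2 l, l <> Lodot & forall x y, x \in B1 -> y \in B2 -> (e x y <-> l = L1).
  case: X => X; [exists L1|exists L0] => // x y xB yB; first by rewrite X.
  by rewrite (negbTE (X x y xB yB)).
by do 5!eexists; rewrite -U; apply: (cotree_join es ct1 ct2 n1 I0 ll lX).
Qed.

(** A root that is a leaf reaches no other leaf. It follows that the leaf of [v] has a parent in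
    either tree, which gives the hybrid-vertex its two parents. *)
Lemma cotree_root_neq (T : finType) (e : rel T) (A : {set T}) (V : finType) (arc : rel V) r t f v :
  cotree e A arc r t f -> v \in A -> 1 < #|A| -> r != f v.
Proof.
move=> ct vA A1; apply/negP => /eqP E.
have lv : leaf arc r by apply/(cotree_leaf ct); exists v.
suff : A \subset [set v] by move/subset_leq_card; rewrite cards1 leqNgt A1.
apply/subsetP => x xA; apply/set1P; apply: (cotree_inj ct xA vA); rewrite -E.
exact: connect_leaf lv (root_reaches_all (cotree_acyclic ct) (cotree_parent ct) _).
Qed.

Lemma indeg_eq1 (V : finType) (arc : rel V) x :
  (exists u, arc u x) -> (forall u u', arc u x -> arc u' x -> u = u') -> indeg arc x = 1.
Proof.
case=> u ux uq; apply/eqP/cards1P; exists u; apply/setP => u'; rewrite !inE.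
by apply/idP/eqP => [u'x|->//]; apply: uq.
Qed.

(** * From pseudo-cographs to networks *)

Section GlueNetwork.
Variables (T : finType) (e : rel T) (A1 A2 : {set T}) (V1 V2 : finType).
Variables (arc1 : rel V1) (arc2 : rel V2) (r1 : V1) (r2 : V2).
Variables (t1 : V1 -> label) (t2 : V2 -> label) (f1 : T -> V1) (f2 : T -> V2) (v : T).
Hypotheses (ct1 : cotree e A1 arc1 r1 t1 f1) (ct2 : cotree e A2 arc2 r2 t2 f2).
Hypothesis cap : A1 :&: A2 = [set v].
Hypotheses (A1_gt1 : 1 < #|A1|) (A2_gt1 : 1 < #|A2|).

Local Notation garc := (glue_arc arc1 arc2 r1 (f1 v) r2 (f2 v) true).
Local Notation eta := (Some (inr (f2 v)) : option (V1 + V2)).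

Lemma glue_net_v : true -> [/\ v \in A1, v \in A2, f1 v = f1 v & f2 v = f2 v].
Proof. by have := set11 v; rewrite -cap inE => /andP[]. Qed.

Let v1A : v \in A1. Proof. by case: glue_net_v. Qed.
Let v2A : v \in A2. Proof. by case: glue_net_v. Qed.

Lemma glue_net_cap x : x \in A1 -> x \in A2 -> true /\ x = v.
Proof. by move=> x1 x2; split=> //; apply/set1P; rewrite -cap inE x1. Qed.

Let acy : acyclic garc := glue_cotrees_acyclic ct1 ct2 glue_net_v.
Let gconnect := glue_cotrees_connect ct1 ct2 glue_net_v.
Let leaf1 : leaf arc1 (f1 v). Proof. by apply/(cotree_leaf ct1); exists v. Qed.
Let leaf2 : leaf arc2 (f2 v). Proof. by apply/(cotree_leaf ct2); exists v. Qed.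
Let r1v : r1 != f1 v := cotree_root_neq ct1 v1A A1_gt1.
Let r2v : r2 != f2 v := cotree_root_neq ct2 v2A A2_gt1.

Lemma eta_parents : exists p1 p2, [/\ arc1 p1 (f1 v), arc2 p2 (f2 v) &
  forall u, garc u eta = (u == Some (inl p1)) || (u == Some (inr p2))].
Proof.
have [|p1 a1] := cotree_parent ct1 (x := f1 v); first by rewrite eq_sym.
have [|p2 a2] := cotree_parent ct2 (x := f2 v); first by rewrite eq_sym.
exists p1, p2; split=> // -[[a|a]|] /=.
- rewrite eqxx orbF /=; apply/idP/eqP => [a1'|[->//]].
  by rewrite (cotree_unique ct1 a1 a1').
- apply/idP/eqP => [a2'|[->//]].
  by rewrite (cotree_unique ct2 a2 a2').
by rewrite eq_sym (negbTE r2v).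
Qed.

Lemma indeg_eta : indeg garc eta = 2.
Proof.
have [p1 [p2 [_ _ H]]] := eta_parents.
apply/eqP/cards2P; exists (Some (inl p1)), (Some (inr p2)); split=> //.
by apply/setP => u; rewrite inE H !inE.
Qed.

Lemma eta_children u : garc eta u = (u == Some (inl (f1 v))).
Proof.
case: u => [[a|a]|] //=; first by rewrite eqxx.
by rewrite (negbTE (elimT (leafP _ _) leaf2 a)).
Qed.

Lemma outdeg_eta : outdeg garc eta = 1.
Proof.
by apply/eqP/cards1P; exists (Some (inl (f1 v))); apply/setP => u; rewrite inE eta_children !inE.
Qed.

Lemma glue_net_unique u u' x : x != eta -> garc u x -> garc u' x -> u = u'.
Proof.
move=> nx; apply: glue_unique_parents => //.
- exact: cotree_unique ct1.
- exact: cotree_unique ct2.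
- exact: cotree_source ct1.
- exact: cotree_source ct2.
Qed.

Lemma indeg_not_eta x : x != None -> x != eta -> indeg garc x = 1.
Proof.
move=> x0 xe; apply: indeg_eq1; last by move=> u u'; apply: glue_net_unique.
by apply: glue_parent x0; [exact: cotree_parent ct1 | exact: cotree_parent ct2].
Qed.

Lemma indeg_root : indeg garc None = 0.
Proof. by apply/eqP; rewrite cards_eq0; apply/eqP/setP => u; rewrite !inE; case: u => [[]|]. Qed.

Lemma outdeg_not_eta x : x != eta -> ~~ leaf garc x -> 1 < outdeg garc x.
Proof.
move=> xe; rewrite /leaf cards_eq0 => /set0Pn[y]; rewrite inE => xy.
have [||| y' yy' xy'] := glue_branching (h := true) _ _ _ xy.
- exact: cotree_branching ct1.
- exact: cotree_branching ct2.
- by [].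
by apply/card_gt1P; exists y', y; rewrite !inE.
Qed.

Lemma glue_is_network : is_network garc.
Proof.
split=> //; right; exists None; split.
- exact: indeg_root.
- apply: outdeg_not_eta => //; exact: glue_leaf_root.
move=> x x0; case: (eqVneq x eta) => [->|xe].
  by constructor 3; rewrite indeg_eta outdeg_eta.
rewrite (indeg_not_eta x0 xe); have [/eqP lx|nx] := boolP (leaf garc x); first by constructor 1.
by constructor 2; split=> //; apply: outdeg_not_eta.
Qed.

Lemma hybrid_eta x : hybrid garc x = (x == eta).
Proof.
rewrite /hybrid; case: (eqVneq x eta) => [->|xe]; first by rewrite indeg_eta.
case: (eqVneq x None) => [->|x0]; first by rewrite indeg_root.
by rewrite indeg_not_eta.
Qed.

Lemma glue_level1 : level1 garc.
Proof.
split; first exact: glue_is_network.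
move=> B _; apply: leq_trans (subset_leq_card (_ : _ \subset [set eta])) _; last by rewrite cards1.
by apply/subsetP => x; rewrite !inE hybrid_eta => /andP[_].
Qed.

(* Without the root and the hybrid-vertex, the two parents of the hybrid-vertex are disconnected. *)
Lemma big_biconnected B : biconnected_set garc B -> 2 < #|B| -> None \in B /\ eta \in B.
Proof.
move=> bB B2; have [w [q1 [q2 [wB q1B q2B q12 [a1 a2]]]]] := biconnected_sink acy bB B2.
have E : w = eta.
  by apply/eqP; apply: contraNT q12 => we; rewrite (glue_net_unique we a1 a2).
rewrite E in wB a1 a2; split=> //.
have [p1 [p2 [ap1 ap2 H]]] := eta_parents.
have pB : Some (inl p1) \in B /\ Some (inr p2) \in B.
  move: a1 a2 q12 q1B q2B; rewrite !H => /orP[] /eqP-> /orP[] /eqP->; rewrite ?eqxx //.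
have p1v : p1 != f1 v by apply: contraTneq ap1 => ->; apply/leafP.
have p2v : p2 != f2 v by apply: contraTneq ap2 => ->; apply/leafP.
have neq2 (a : V2) : a != f2 v -> Some (inr a) != eta by apply: contraNneq => -[->].
apply: contraT => nB.
have := @uconnected_setD1 _ _ _ eta bB (Some (inl p1)) (Some (inr p2)).
rewrite !inE (proj1 pB) (proj2 pB) neq2 // => /(_ isT isT).
(* The first tree without the leaf of [v]: its edges to the outside all end in the root or in [eta],
   which are both absent here. *)
pose left_part (z : option (V1 + V2)) := if z is Some (inl a) then a != f1 v else false.
suff : forall a b, left_part a -> uadj_in garc (B :\ eta) a b -> left_part b.
  by move=> inv /(connect_invariant inv)-/(_ p1v).
move=> [[a|a]|] // b /= av /and3P[_ /setD1P[be bB']].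
case: b be bB' => [[b|b]|] be bB' //.
- case/orP => /=; first by case/andP.
  by case/andP => ba _; apply: contraTneq ba => ->; apply/leafP.
- case/orP => /= /andP[/eqP E']; first by rewrite E' eqxx in be.
  by rewrite E' eqxx in be.
by rewrite bB' in nB.
Qed.

(** Either tree reaches the other only through [eta], so the root is the lowest common ancestor of
    the parents of [eta], and these yield a cycle. Two cycles share the root and [eta], so their
    union is biconnected and equals both by maximality. *)
Lemma glue_cycle : exists C : {set option (V1 + V2)},
  [/\ is_cycle garc C, (forall C' : {set _}, is_cycle garc C' -> C' = C),
      (forall rho, net_root garc rho -> cycle_root garc C rho) & cycle_hybrid garc C eta].
Proof.
have [p1 [p2 [ap1 ap2 H]]] := eta_parents.
have g1 : garc (Some (inl p1)) eta by rewrite H eqxx.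
have g2 : garc (Some (inr p2)) eta by rewrite H eqxx orbT.
have p1v : p1 != f1 v by apply: contraTneq ap1 => ->; apply/leafP.
have p2v : p2 != f2 v by apply: contraTneq ap2 => ->; apply/leafP.
have lca : is_lca garc (Some (inl p1)) (Some (inr p2)) None.
  split; first by rewrite gconnect.
  split=> [|w]; first by rewrite gconnect.
  by rewrite !gconnect; case: w => [[a|a]|] //= _ _; rewrite ?(negbTE p1v) ?(negbTE p2v) ?andbF.
have [//|B [bB _ _ B2]] := two_parents_biconnected acy _ g1 g2 lca.
have [C bC BC] := bicomponent_exists bB.
have C2 : 2 < #|C| := leq_trans B2 (subset_leq_card BC).
have [rC eC] := big_biconnected (proj1 bC) C2.
exists C; split=> //.
- move=> C' [bC' C2']; have [rC' eC'] := big_biconnected (proj1 bC') C2'.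
  have bU := biconnected_setU (isT : None != eta) rC eC rC' eC' (proj1 bC) (proj1 bC').
  rewrite -(proj2 bC _ bU (subsetUl _ _)).
  by rewrite -[LHS](proj2 bC' _ bU (subsetUr _ _)).
- move=> rho r0; case: (eqVneq rho None) => [->|rn]; first by split=> // -[[]|].
  by move: r0; rewrite /net_root; case: (eqVneq rho eta) => [->|re];
    rewrite ?indeg_eta ?indeg_not_eta.
by split=> //; rewrite hybrid_eta.
Qed.

End GlueNetwork.

Theorem mainTheorem6 (T : finType) (e : rel T)
    (e_sym : symmetric e) (e_irr : irreflexive e) :
  pseudo_cograph e <->
  (#|T| <= 2 \/
   exists (V : finType) (arc : rel V) (t : V -> label),
     [/\ level1 arc, labeling arc t, explains e arc t &
         exists C : {set V},
           [/\ is_cycle arc C,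
               (forall C' : {set V}, is_cycle arc C' -> C' = C),
               (forall rho : V, net_root arc rho -> cycle_root arc C rho) &
               exists h : V, [/\ cycle_hybrid arc C h, outdeg arc h = 1 &
                                 forall c, arc h c -> leaf arc c]]]).
Proof.
split; last first.
  case=> [|[V [arc [t [lev _ expl [C [cyc uniqC rootC [h [hybC out1 hleaf]]]]]]]]]; first by left.
  exact: network_pseudo_cograph e_sym e_irr lev expl cyc uniqC rootC hybC out1 hleaf.
case=> [|[A1 [A2 [v [U cap [A1_gt1 A2_gt1] [cog1 cog2] X]]]]]; first by left.
have n1 : A1 != set0 by rewrite -card_gt0 ltnW.
have n2 : A2 != set0 by rewrite -card_gt0 ltnW.
have [V1 [a1 [r1 [t1 [f1 ct1]]]]] := cotree_exists e_sym e_irr n1 cog1.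
have [V2 [a2 [r2 [t2 [f2 ct2]]]]] := cotree_exists e_sym e_irr n2 cog2.
have [v1A v2A _ _] := glue_net_v f1 f2 cap isT.
(* The label of the new root records whether G - v is a join or a disjoint union; lying in only one
   of [A1], [A2] amounts to being different from [v]. *)
have [l ll lX] : exists2 l, l <> Lodot & forall x y, x \in A1 -> x \notin A2 ->
    y \in A2 -> y \notin A1 -> (e x y <-> l = L1).
  have D x y : x \in A1 -> x \notin A2 -> y \in A2 -> y \notin A1 ->
      x \in A1 :\ v /\ y \in A2 :\ v.
    move=> x1 x2 y2 y1; rewrite !inE x1 y2 !andbT.
    by split; [apply: contraNneq x2 => -> | apply: contraNneq y1 => ->].
  case: X => X; [exists L1|exists L0] => // x y x1 x2 y2 y1;
    have [xA yA] := D x y x1 x2 y2 y1; first by rewrite X.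
  by rewrite (negbTE (X x y xA yA)).
have r1v := cotree_root_neq ct1 v1A A1_gt1.
have hv := glue_net_v f1 f2 cap.
have cap' := glue_net_cap cap.
right; exists (option (V1 + V2)), (glue_arc a1 a2 r1 (f1 v) r2 (f2 v) true).
exists (glue_label (f2 v) t1 t2 true l); split.
- exact: glue_level1 ct1 ct2 cap A1_gt1 A2_gt1.
- exact: (glue_labeling _ _ _ ct1 ct2 ll).
- have inU x : x \in A1 :|: A2 by rewrite U inE.
  exists (glue_map A1 f1 f2); split.
  + move=> x y; exact: (glue_map_inj ct1 ct2 (inU x) (inU y)).
  + by move=> x; apply/(glue_map_leaf ct1 ct2 hv cap'); exists x.
  + by move=> w /(glue_map_leaf ct1 ct2 hv cap')[x _ <-]; exists x.
  by move=> x y xy w; apply: (glue_explains e_sym ct1 ct2 hv cap' lX).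
have [C [cyc uniqC rootC hybC]] := glue_cycle ct1 ct2 cap A1_gt1 A2_gt1.
exists C; split=> //; exists (Some (inr (f2 v))); split=> //.
  exact: outdeg_eta ct2 cap.
move=> c; rewrite (eta_children _ _ _ ct2 cap) => /eqP->.
by rewrite glue_leafl; apply/(cotree_leaf ct1); exists v.
Qed.
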